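(* For every Petri net $N$, the equality $\Psi(\Phi(N))=N$ holds and the reduction graphs $G(N)$ and $G(\Phi(N))$ are isomorphic; furthermore, this isomorphism identifies the congruences $\equiv_N$ and $\equiv_{\Phi(N)}$. Conversely, for every finite commutative word rewriting system $(X,R)$, the equality $\Phi(\Psi(X,R))=(X,R)$ holds and the reduction graphs $G(X,R)$ and $G(\Psi(X,R))$ are isomorphic; furthermore, this isomorphism identifies the congruences $\equiv_{(X,R)}$ and $\equiv_{\Psi(X,R)}$.
   Context: Graphs are directed and may have parallel arrows. A congruence on the paths of a graph is an equivalence relation between parallel paths (same source, same target) that is compatible with concatenation of paths. An isomorphism of graphs identifies two congruences when the induced bijection on paths carries one onto the other. Petri nets. A Petri net is a quadruple $N=(X,T,w,w')$ with $X$ (places) and $T$ (transitions) finite sets and $w:X\times T\to\mathbb{N}$, $w':T\times X\to\mathbb{N}$ maps. A marking of $N$ is a map $X\to\mathbb{N}$. For $\alpha\in T$ and markings $\mu,\nu$, write $\mu\to_\alpha\nu$ if for every $x\in X$: $\mu(x)\geq w(x,\alpha)$ and $\nu(x)=\mu(x)-w(x,\alpha)+w'(\alpha,x)$. The reduction graph $G(N)$ has the markings of $N$ as objects and one arrow from $\mu$ to $\nu$ for each transition $\alpha$ such that $\mu\to_\alpha\nu$. The relation $\equiv_N$ is the congruence on paths of $G(N)$ generated by identifying the paths $\mu_1\to_\alpha\nu_1\to_\beta\mu_2$ and $\mu_1\to_\beta\nu_2\to_\alpha\mu_2$ whenever there is a marking $\rho$ such that, for every $x\in X$: $\mu_1(x)=\rho(x)+w(x,\alpha)+w(x,\beta)$,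 $\nu_1(x)=\rho(x)+w'(\alpha,x)+w(x,\beta)$, $\nu_2(x)=\rho(x)+w(x,\alpha)+w'(\beta,x)$, $\mu_2(x)=\rho(x)+w'(\alpha,x)+w'(\beta,x)$. Commutative word rewriting systems. For a set $X$, $[X]$ is the free commutative monoid on $X$, written additively: its elements are the finite formal sums $a=\sum_{x\in X}a_x.x$ with $a_x\in\mathbb{N}$. A finite commutative word rewriting system is a pair $(X,R)$ with $X$ a finite set (the alphabet) and $R$ a finite family of pairs $\alpha=(s(\alpha),t(\alpha))$ of elements of $[X]$ (the rules). Its reduction graph $G(X,R)$ has the elements of $[X]$ as objects, and its arrows are the pairs $(c,\alpha)$, also written $c+\alpha$, with $c\in[X]$ and $\alpha\in R$; the arrow $c+\alpha$ has source $c+s(\alpha)$ and target $c+t(\alpha)$. The relation $\equiv_{(X,R)}$ is the congruence on paths of $G(X,R)$ generated by identifying, for all $\alpha,\beta\in R$ and $c\in[X]$, the path ''$(c+s(\beta))+\alpha$ followed by $(c+t(\alpha))+\beta$'' with the path ''$(c+s(\alpha))+\beta$ followed by $(c+t(\beta))+\alpha$'' (both from $c+s(\alpha)+s(\beta)$ to $c+t(\alpha)+t(\beta)$). Translations. For a Petri net $N=(X,T,w,w')$, $\Phi(N)$ is the finite commutative word rewriting system with alphabet $X$ whose rules are the transitions $\alpha\in T$, seen as the pairs $s(\alpha)=\sum_{x\in X}w(x,\alpha).x$, $t(\alpha)=\sum_{x\in X}w'(\alpha,x).x$. For a finite commutative word rewriting system $(X,R)$, $\Psi(X,R)$ is the Petri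 net with $X$ as set of places, one transition for each rule in $R$, and weights $w(x,\alpha)=s(\alpha)_x$, $w'(\alpha,x)=t(\alpha)_x$. *)

(* Defs.v *)
From HB Require Import structures.
From mathcomp Require Import all_boot finmap multiset.

Set Implicit Arguments.
Unset Strict Implicit.
Unset Printing Implicit Defensive.

Local Open Scope mset_scope.
Local Open Scope nat_scope.

(** * Directed graphs with parallel arrows, paths, congruences *)

Record graph := Graph {
  object : Type;
  arrow : Type;
  source : arrow -> object;
  target : arrow -> object
}.

(* A path is given by its two endpoints and the sequence of its arrows, in the
   order in which they are followed; the endpoints determine the empty paths. *)
Fixpoint is_path (G : graph) (x : object G) (p : seq (arrow G)) (y : object G)
    : Prop :=
  if p is e :: p' then source e = x /\ is_path (target e) p' y else x = y.

Definition path_rel (G : graph) : Type :=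
  object G -> object G -> seq (arrow G) -> seq (arrow G) -> Prop.

Record is_congruence (G : graph) (C : path_rel G) : Prop := IsCongruence {
  cong_parallel : forall x y p q, C x y p q -> is_path x p y /\ is_path x q y;
  cong_refl : forall x y p, is_path x p y -> C x y p p;
  cong_sym : forall x y p q, C x y p q -> C x y q p;
  cong_trans : forall x y p q r, C x y p q -> C x y q r -> C x y p r;
  cong_cat : forall x y z p q p' q',
    C x y p q -> C y z p' q' -> C x z (p ++ p') (q ++ q')
}.

Definition congruence_generated (G : graph) (E : path_rel G) : path_rel G :=
  fun x y p q => forall C : path_rel G, is_congruence C ->
    (forall x' y' p' q', E x' y' p' q' -> C x' y' p' q') -> C x y p q.

Record graph_iso (G H : graph) := GraphIso {
  iso_object : object G -> object H;
  iso_arrow : arrow G -> arrow H;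
  iso_object_bij : bijective iso_object;
  iso_arrow_bij : bijective iso_arrow;
  iso_source : forall e, source (iso_arrow e) = iso_object (source e);
  iso_target : forall e, target (iso_arrow e) = iso_object (target e)
}.

(* The bijection induced on paths sends the path p from x to y to the path
   map (iso_arrow f) p from iso_object f x to iso_object f y. *)
Definition identifies (G H : graph) (f : graph_iso G H)
    (C : path_rel G) (D : path_rel H) : Prop :=
  forall x y p q, is_path x p y -> is_path x q y ->
    (C x y p q <->
     D (iso_object f x) (iso_object f y)
       (map (iso_arrow f) p) (map (iso_arrow f) q)).

(** * Petri nets *)

Record petri_net := PetriNet {
  place : finType;
  transition : finType;
  weight_in : {ffun place * transition -> nat};
  weight_out : {ffun transition * place -> nat}
}.

Definition marking (N : petri_net) : Type := {ffun place N -> nat}.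

(* The subtraction is truncated, but the first conjunct makes it exact. *)
Definition fires (N : petri_net) (m : marking N) (a : transition N)
    (n : marking N) : bool :=
  [forall x : place N, (weight_in N (x, a) <= m x) &&
    (n x == m x - weight_in N (x, a) + weight_out N (a, x))].

Definition petri_arrow (N : petri_net) : Type :=
  {e : marking N * transition N * marking N | fires e.1.1 e.1.2 e.2}.

Definition petri_graph (N : petri_net) : graph :=
  @Graph (marking N) (petri_arrow N)
    (fun e => (val e).1.1) (fun e => (val e).2).

Definition firing (N : petri_net) (m : marking N) (a : transition N)
    (n : marking N) (mn : fires m a n) : arrow (petri_graph N) :=
  exist _ (m, a, n) mn.

Inductive petri_swap (N : petri_net) : path_rel (petri_graph N) :=
| PetriSwap (a b : transition N) (m1 n1 n2 m2 r : marking N)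
    (m1n1 : fires m1 a n1) (n1m2 : fires n1 b m2)
    (m1n2 : fires m1 b n2) (n2m2 : fires n2 a m2) :
    (forall x : place N,
      [/\ m1 x = r x + weight_in N (x, a) + weight_in N (x, b),
          n1 x = r x + weight_out N (a, x) + weight_in N (x, b),
          n2 x = r x + weight_in N (x, a) + weight_out N (b, x)
        & m2 x = r x + weight_out N (a, x) + weight_out N (b, x)]) ->
    @petri_swap N m1 m2 [:: firing m1n1; firing n1m2]
                        [:: firing m1n2; firing n2m2].

Definition petri_congruence (N : petri_net) : path_rel (petri_graph N) :=
  congruence_generated (@petri_swap N).

(** * Finite commutative word rewriting systems *)

(* The free commutative monoid on X is {mset X}, with addition `+`; the
   coefficient of x in a is a x, and n.x is msetn n x. *)
Record cwrs := Cwrs {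
  letter : finType;
  rule : finType;
  rule_pair : {ffun rule -> {mset letter} * {mset letter}}
}.

Definition lhs (S : cwrs) (a : rule S) : {mset letter S} := (rule_pair S a).1.
Definition rhs (S : cwrs) (a : rule S) : {mset letter S} := (rule_pair S a).2.

Definition cwrs_graph (S : cwrs) : graph :=
  @Graph {mset letter S} ({mset letter S} * rule S)
    (fun e => e.1 `+` lhs e.2) (fun e => e.1 `+` rhs e.2).

Inductive cwrs_swap (S : cwrs) : path_rel (cwrs_graph S) :=
| CwrsSwap (a b : rule S) (c : {mset letter S}) :
    @cwrs_swap S (c `+` lhs a `+` lhs b) (c `+` rhs a `+` rhs b)
      [:: (c `+` lhs b, a); (c `+` rhs a, b)]
      [:: (c `+` lhs a, b); (c `+` rhs b, a)].

Definition cwrs_congruence (S : cwrs) : path_rel (cwrs_graph S) :=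
  congruence_generated (@cwrs_swap S).

(** * Translations *)

Definition Phi (N : petri_net) : cwrs :=
  @Cwrs (place N) (transition N)
    [ffun a => (\big[@msetD (place N)/mset0]_x msetn (weight_in N (x, a)) x,
                \big[@msetD (place N)/mset0]_x msetn (weight_out N (a, x)) x)].

Definition Psi (S : cwrs) : petri_net :=
  @PetriNet (letter S) (rule S)
    [ffun xa => lhs xa.2 xa.1] [ffun ax => rhs ax.1 ax.2].

(* Main.v *)
(* A firing mu ->_alpha nu of N is determined by alpha and the residual marking
   c = mu - w(-, alpha), which exists exactly when alpha is enabled at mu; the
   pair (c, alpha) is the corresponding arrow of G(Phi(N)).  Under this bijection
   the generating pairs of the two congruences match, the marking rho playing the
   role of the context c.  The second half is the first one applied to
   N = Psi(S), read backwards along Phi(Psi(S)) = S. *)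
From mathcomp Require Import all_boot finmap multiset zify.
Require Import Defs.

Set Implicit Arguments.
Unset Strict Implicit.
Unset Printing Implicit Defensive.

Local Open Scope mset_scope.
Local Open Scope nat_scope.

(** * Graph morphisms and the transport of generated congruences *)

Definition is_graph_hom (G H : graph) (fo : object G -> object H)
    (fa : arrow G -> arrow H) : Prop :=
  forall e, source (fa e) = fo (source e) /\ target (fa e) = fo (target e).

Lemma iso_is_graph_hom (G H : graph) (f : graph_iso G H) :
  is_graph_hom (iso_object f) (iso_arrow f).
Proof. by move=> e; rewrite iso_source iso_target. Qed.

Lemma is_path_map (G H : graph) fo fa (x y : object G) p :
  @is_graph_hom G H fo fa -> is_path x p y -> is_path (fo x) (map fa p) (fo y).
Proof.
move=> hom; elim: p x => [|e p IHp] x /=; first by move=> ->.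
by case: (hom e) => -> -> [<- /IHp].
Qed.

Lemma is_path_cat (G : graph) (x y z : object G) p q :
  is_path x p y -> is_path y q z -> is_path x (p ++ q) z.
Proof.
elim: p x => [|e p IHp] x /=; first by move=> ->.
by move=> [-> py] qz; split=> //; apply: IHp.
Qed.

(** Being a path is required separately: [fo] and [fa] need not be injective, so the images can be
    parallel paths when the originals are not. *)
Lemma congruence_preimage (G H : graph) fo fa (C : path_rel H) :
  @is_graph_hom G H fo fa -> is_congruence C ->
  is_congruence (fun x y p q => [/\ is_path x p y, is_path x q y
    & C (fo x) (fo y) (map fa p) (map fa q)]).
Proof.
move=> hom [_ Crefl Csym Ctrans Ccat]; split.
- by move=> x y p q [].
- by move=> x y p px; split=> //; apply/Crefl/is_path_map.
- by move=> x y p q [? ? /Csym].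
- by move=> x y p q r [? ? Cpq] [? ? /(Ctrans _ _ _ _ _ Cpq)].
- move=> x y z p q p' q' [? ? Cpq] [? ? /(Ccat _ _ _ _ _ _ _ Cpq)].
  by rewrite -!map_cat; split=> //; apply: (@is_path_cat _ x y z).
Qed.

(** The preimage of any congruence containing [D] is a congruence containing [E], hence contains the
    one generated by [E]. *)
Lemma congruence_generated_map (G H : graph) fo fa
    (E : path_rel G) (D : path_rel H) :
  @is_graph_hom G H fo fa ->
  (forall x y p q, E x y p q -> is_path x p y /\ is_path x q y) ->
  (forall x y p q, E x y p q -> D (fo x) (fo y) (map fa p) (map fa q)) ->
  forall x y p q, congruence_generated E x y p q ->
    congruence_generated D (fo x) (fo y) (map fa p) (map fa q).
Proof.
move=> hom Epar ED x y p q Epq C congC DC.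
have [] // := Epq _ (congruence_preimage hom congC) => x' y' p' q' Epq'.
by case: (Epar _ _ _ _ Epq') => ? ?; split=> //; apply/DC/ED.
Qed.

(** Generators are transported in both directions; mapping a path forth and back returns it, which
    gives the converse implication. *)
Lemma identifies_generated (G H : graph) (f : graph_iso G H)
    (go : object H -> object G) (ga : arrow H -> arrow G)
    (E : path_rel G) (D : path_rel H) :
  is_graph_hom go ga -> cancel (iso_object f) go -> cancel (iso_arrow f) ga ->
  (forall x y p q, E x y p q -> is_path x p y /\ is_path x q y) ->
  (forall x y p q, D x y p q -> is_path x p y /\ is_path x q y) ->
  (forall x y p q, E x y p q ->
    D (iso_object f x) (iso_object f y)
      (map (iso_arrow f) p) (map (iso_arrow f) q)) ->
  (forall x y p q, D x y p q -> E (go x) (go y) (map ga p) (map ga q)) ->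
  identifies f (congruence_generated E) (congruence_generated D).
Proof.
move=> ghom foK faK Epar Dpar ED DE x y p q _ _; split.
  exact: (congruence_generated_map (iso_is_graph_hom f)).
move/(congruence_generated_map ghom Dpar DE).
by rewrite !foK !(mapK faK).
Qed.

Lemma identifies_sym (G H : graph) (f : graph_iso G H)
    (C : path_rel G) (D : path_rel H) :
  identifies f C D -> exists g : graph_iso H G, identifies g D C.
Proof.
move=> CD; have [go foK goK] := iso_object_bij f.
have [ga faK gaK] := iso_arrow_bij f.
have gs e : source (ga e) = go (source e).
  by apply: (can_inj foK); rewrite -iso_source gaK goK.
have gt e : target (ga e) = go (target e).
  by apply: (can_inj foK); rewrite -iso_target gaK goK.
exists (GraphIso (Bijective goK foK) (Bijective gaK faK) gs gt).
move=> x y p q xp xq /=; have ghom : is_graph_hom go ga by [].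
have := CD _ _ _ _ (is_path_map ghom xp) (is_path_map ghom xq).
by rewrite !goK !(mapK gaK) => -[? ?]; split.
Qed.

(** * Markings as elements of the free commutative monoid *)

Lemma big_msetnE (X : finType) (F : X -> nat) (y : X) :
  (\big[@msetD X/mset0]_x msetn (F x) x) y = F y.
Proof.
(* Taking the coefficient of [y] is a monoid morphism to the natural numbers, and only the summand
   at [y] contributes. *)
rewrite (big_morph (fun A : {mset X} => A y) (id1 := 0) (op1 := addn)).
- rewrite (bigD1 y) //= msetnE eqxx big1 ?addn0 // => x xy.
  by rewrite msetnE eq_sym (negPf xy).
- by move=> A B; rewrite msetE2.
- by rewrite mset0E.
Qed.

Definition mset_of_ffun (X : finType) (m : {ffun X -> nat}) : {mset X} :=
  \big[@msetD X/mset0]_x msetn (m x) x.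

Definition ffun_of_mset (X : finType) (a : {mset X}) : {ffun X -> nat} :=
  [ffun x => a x].

Lemma mset_of_ffunE (X : finType) (m : {ffun X -> nat}) x :
  mset_of_ffun m x = m x.
Proof. exact: big_msetnE. Qed.

Lemma mset_of_ffunK (X : finType) :
  cancel (@mset_of_ffun X) (@ffun_of_mset X).
Proof. by move=> m; apply/ffunP=> x; rewrite ffunE mset_of_ffunE. Qed.

Lemma ffun_of_msetK (X : finType) :
  cancel (@ffun_of_mset X) (@mset_of_ffun X).
Proof. by move=> a; apply/msetP=> x; rewrite mset_of_ffunE ffunE. Qed.

(** * The translations are mutually inverse *)

Lemma lhs_PhiE (N : petri_net) (a : transition N) (x : place N) :
  lhs (a : rule (Phi N)) x = weight_in N (x, a).
Proof. by rewrite /lhs ffunE big_msetnE. Qed.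

Lemma rhs_PhiE (N : petri_net) (a : transition N) (x : place N) :
  rhs (a : rule (Phi N)) x = weight_out N (a, x).
Proof. by rewrite /rhs ffunE big_msetnE. Qed.

Lemma PhiK : cancel Phi Psi.
Proof.
case=> X T w w'; rewrite /Psi; congr PetriNet; apply/ffunP=> -[u v].
  by rewrite ffunE lhs_PhiE.
by rewrite ffunE rhs_PhiE.
Qed.

Lemma PsiK : cancel Psi Phi.
Proof.
case=> X T r; rewrite /Phi; congr Cwrs; apply/ffunP=> a.
rewrite [LHS]ffunE [RHS]surjective_pairing.
by congr pair; apply/msetP=> x; rewrite big_msetnE ffunE.
Qed.

Lemma firesP (N : petri_net) (m n : marking N) (a : transition N) :
  reflect (forall x, weight_in N (x, a) <= m x /\
             n x = m x - weight_in N (x, a) + weight_out N (a, x))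
          (fires m a n).
Proof.
apply: (iffP forallP) => mn x; first by have /andP[? /eqP] := mn x.
by have [-> ->] := mn x; rewrite eqxx.
Qed.

(** * The isomorphism between the reduction graphs of [N] and [Phi N] *)

Section PhiGraph.
Variable N : petri_net.

Lemma fires_mset (c : {mset place N}) (a : transition N) :
  fires (ffun_of_mset (c `+` lhs (a : rule (Phi N))) : marking N) a
        (ffun_of_mset (c `+` rhs (a : rule (Phi N)))).
Proof. by apply/firesP=> x; rewrite !ffunE !msetE2 lhs_PhiE rhs_PhiE addnK leq_addl. Qed.

Definition Phi_arrow (e : petri_arrow N) : arrow (cwrs_graph (Phi N)) :=
  (mset_of_ffun [ffun x => (val e).1.1 x - weight_in N (x, (val e).1.2)],
   (val e).1.2).

Definition Phi_arrow_inv (e : arrow (cwrs_graph (Phi N))) : petri_arrow N :=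
  firing (fires_mset e.1 e.2).

Lemma Phi_arrow_source e :
  source (Phi_arrow e) = mset_of_ffun (source (e : arrow (petri_graph N))).
Proof.
case: e => -[[m a] n] mn; apply/msetP=> x /=.
have [? _] := firesP _ _ _ mn x.
by rewrite msetE2 !mset_of_ffunE ffunE lhs_PhiE subnK.
Qed.

Lemma Phi_arrow_target e :
  target (Phi_arrow e) = mset_of_ffun (target (e : arrow (petri_graph N))).
Proof.
case: e => -[[m a] n] mn; apply/msetP=> x /=.
have [_ nE] := firesP _ _ _ mn x.
by rewrite msetE2 !mset_of_ffunE ffunE rhs_PhiE nE.
Qed.

Lemma Phi_arrowK : cancel Phi_arrow Phi_arrow_inv.
Proof.
(* Firing is a boolean condition, so an arrow is determined by its triple; the two endpoint lemmas
   then recover both markings. *)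
move=> e; apply: val_inj => /=.
have /= -> := Phi_arrow_source e; have /= -> := Phi_arrow_target e.
by rewrite !mset_of_ffunK; case: e => -[[]].
Qed.

Lemma Phi_arrow_invK : cancel Phi_arrow_inv Phi_arrow.
Proof.
case=> c a; congr pair; apply/msetP=> x /=.
by rewrite mset_of_ffunE !ffunE msetE2 lhs_PhiE addnK.
Qed.

Definition Phi_iso : graph_iso (petri_graph N) (cwrs_graph (Phi N)) :=
  @GraphIso (petri_graph N) (cwrs_graph (Phi N)) _ _
    (Bijective (@mset_of_ffunK (place N)) (@ffun_of_msetK (place N)))
    (Bijective Phi_arrowK Phi_arrow_invK) Phi_arrow_source Phi_arrow_target.

Lemma petri_swap_parallel x y p q :
  @petri_swap N x y p q -> is_path x p y /\ is_path x q y.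
Proof. by case. Qed.

Lemma cwrs_swap_parallel (S : cwrs) x y p q :
  @cwrs_swap S x y p q -> is_path x p y /\ is_path x q y.
Proof.
case=> a b c; split; split; [exact: msetDAC | split; last exact: erefl |
  exact: erefl | split]; exact: msetDAC.
Qed.

Lemma petri_swap_Phi x y p q : @petri_swap N x y p q ->
  @cwrs_swap (Phi N) (mset_of_ffun x) (mset_of_ffun y)
    (map Phi_arrow p) (map Phi_arrow q).
Proof.
case=> a b m1 n1 n2 m2 r m1n1 n1m2 m1n2 n2m2 mr /=.
(* The context is [r]. Endpoints and residuals agree with this instance only coefficientwise, for
   instance [m1] minus the input of [a] is [r] plus the input of [b]. *)
have := @CwrsSwap (Phi N) a b (mset_of_ffun r).
congr (cwrs_swap _ _ [:: (_, _); (_, _)] [:: (_, _); (_, _)]);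
  apply/msetP=> z; have [m1E n1E n2E m2E] := mr z;
  rewrite !msetE2 ?mset_of_ffunE ?lhs_PhiE ?rhs_PhiE ?ffunE /=; lia.
Qed.

(** Arrows are constrained only through their triples, so that provably equal markings and arbitrary
    firing proofs are accepted where [PetriSwap] expects literal matches. *)
Lemma petri_swap_val (a b : transition N) (m1 n1 n2 m2 r : marking N)
    (e1 e2 e3 e4 : petri_arrow N) :
  val e1 = (m1, a, n1) -> val e2 = (n1, b, m2) ->
  val e3 = (m1, b, n2) -> val e4 = (n2, a, m2) ->
  (forall x : place N,
    [/\ m1 x = r x + weight_in N (x, a) + weight_in N (x, b),
        n1 x = r x + weight_out N (a, x) + weight_in N (x, b),
        n2 x = r x + weight_in N (x, a) + weight_out N (b, x)
      & m2 x = r x + weight_out N (a, x) + weight_out N (b, x)]) ->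
  @petri_swap N m1 m2 [:: e1; e2] [:: e3; e4].
Proof.
case: e1 e2 e3 e4 => [? p1] [? p2] [? p3] [? p4] /= E1 E2 E3 E4.
by subst; apply: PetriSwap.
Qed.

Lemma cwrs_swap_Phi x y p q : @cwrs_swap (Phi N) x y p q ->
  @petri_swap N (ffun_of_mset x) (ffun_of_mset y)
    (map Phi_arrow_inv p) (map Phi_arrow_inv q).
Proof.
case=> a b c /=.
(* The intermediate markings are those reached after [a] alone and after [b] alone, and [c] is the
   common residual. The first and last arrows match up to reordering a sum. *)
apply: (@petri_swap_val a b _ (ffun_of_mset (c `+` rhs a `+` lhs b))
  (ffun_of_mset (c `+` lhs a `+` rhs b)) _ (ffun_of_mset c)).
- by congr (ffun_of_mset _, a, ffun_of_mset _); exact: msetDAC.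
- exact: erefl.
- exact: erefl.
- by congr (ffun_of_mset _, a, ffun_of_mset _); exact: msetDAC.
- by move=> z; rewrite !ffunE !msetE2 !lhs_PhiE !rhs_PhiE.
Qed.

End PhiGraph.

Lemma Phi_identifies (N : petri_net) :
  identifies (Phi_iso N) (@petri_congruence N) (@cwrs_congruence (Phi N)).
Proof.
apply: (@identifies_generated (petri_graph N) (cwrs_graph (Phi N)) (Phi_iso N)
  (@ffun_of_mset (place N)) (@Phi_arrow_inv N)).
- by [].
- exact: mset_of_ffunK.
- exact: Phi_arrowK.
- exact: petri_swap_parallel.
- exact: cwrs_swap_parallel.
- exact: petri_swap_Phi.
- exact: cwrs_swap_Phi.
Qed.

Theorem theorem2p7 :
  (forall N : petri_net,
     Psi (Phi N) = N /\
     exists f : graph_iso (petri_graph N) (cwrs_graph (Phi N)),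
       identifies f (@petri_congruence N) (@cwrs_congruence (Phi N))) /\
  (forall S : cwrs,
     Phi (Psi S) = S /\
     exists f : graph_iso (cwrs_graph S) (petri_graph (Psi S)),
       identifies f (@cwrs_congruence S) (@petri_congruence (Psi S))).
Proof.
split=> [N|S]; split; [exact: PhiK | | exact: PsiK |].
  by exists (Phi_iso N); exact: Phi_identifies.
have [g] := identifies_sym (@Phi_identifies (Psi S)).
(* The type of [g] mentions [Phi (Psi S)], so [g] is generalized before this system is replaced by
   [S]. *)
by move: g; rewrite PsiK => g ?; exists g.
Qed.
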